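(* Let $G$ be a finite group with $Z(G)=1$. Then $\mathrm{Aut}(\mathcal{D}(G))\cong\mathrm{Aut}(G)\ltimes\mathrm{Hom}(G,\widehat{G})$.
   Context: The base field $\mathbbm{k}$ is algebraically closed of characteristic zero. For a finite group $G$, $\mathbbm{k}^G$ is the linear dual of $\mathbbm{k}G$, with dual basis $\{e_g\}_{g\in G}$ and identity $\varepsilon=\sum_{g}e_g$; $\widehat{G}=\mathrm{Hom}(G,\mathbbm{k}^\times)$ is the group of group-like elements of $\mathbbm{k}^G$. The Drinfeld double $\mathcal{D}(G)$ is the Hopf algebra with basis $e_g\# h$ ($g,h\in G$), multiplication $(e_g\# g')(e_h\# h')=\delta_{g,\,g'hg'^{-1}}\,e_g\# g'h'$, unit $\varepsilon\# 1$, and coalgebra structure $(\mathbbm{k}^G)^{\mathrm{cop}}\otimes\mathbbm{k}G$. $\mathrm{Aut}(\mathcal{D}(G))$ is its group of Hopf algebra automorphisms. In the semidirect product, $\mathrm{Aut}(G)$ acts on the right on the normal abelian subgroup $\mathrm{Hom}(G,\widehat{G})$ by $r^v=v^*rv$, i.e. $r^v(g)=r(v(g))\circ v$. An element $v\in\mathrm{Aut}(G)$ corresponds to the automorphism $e_g\# h\mapsto e_{v(g)}\# v(h)$ and $r\in\mathrm{Hom}(G,\widehat{G})$ to $e_g\# h\mapsto r(h)e_g\# h$. *)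

(* Defs.v *)
From HB Require Import structures.
From mathcomp Require Import all_boot all_order all_algebra all_fingroup all_solvable.
From mathcomp Require Import boolp.

Set Implicit Arguments.
Unset Strict Implicit.
Unset Printing Implicit Defensive.

Import GRing.Theory.
Local Open Scope group_scope.

HB.mixin Record Group_isCommutative A of monoid.Group A := {
  comgC : commutative (@mul A)
}.
HB.structure Definition ComGroup := {A of monoid.Group A & Group_isCommutative A}.
Notation comGroupType := ComGroup.type.

Section Units.
Variable k : fieldType.

Record kunit := KUnit { kunit_val :> k; _ : kunit_val != 0%R }.
HB.instance Definition _ := [isSub for kunit_val].
HB.instance Definition _ := [Choice of kunit by <:].

Lemma kunit_neq0 (a : kunit) : kunit_val a != 0%R. Proof. exact: (valP a). Qed.

Fact kunit_mul_proof (a b : kunit) : (kunit_val a * kunit_val b)%R != 0%R.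
Proof. by rewrite mulf_neq0 ?kunit_neq0. Qed.
Fact kunit_inv_proof (a : kunit) : (kunit_val a)^-1%R != 0%R.
Proof. by rewrite invr_eq0 kunit_neq0. Qed.

Definition kunit_one := KUnit (oner_neq0 k).
Definition kunit_mul a b := KUnit (kunit_mul_proof a b).
Definition kunit_inv a := KUnit (kunit_inv_proof a).

Fact kunit_mulA : associative kunit_mul.
Proof. by move=> a b c; apply: val_inj; exact: mulrA. Qed.
Fact kunit_mul1 : left_id kunit_one kunit_mul.
Proof. by move=> a; apply: val_inj; exact: mul1r. Qed.
Fact kunit_1mul : right_id kunit_one kunit_mul.
Proof. by move=> a; apply: val_inj; exact: mulr1. Qed.
Fact kunit_mulV : left_inverse kunit_one kunit_inv kunit_mul.
Proof. by move=> a; apply: val_inj; apply: mulVf; exact: kunit_neq0. Qed.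
Fact kunit_Vmul : right_inverse kunit_one kunit_inv kunit_mul.
Proof. by move=> a; apply: val_inj; apply: mulfV; exact: kunit_neq0. Qed.
HB.instance Definition _ :=
  isGroup.Build kunit kunit_mulA kunit_mul1 kunit_1mul kunit_mulV kunit_Vmul.
Fact kunit_mulC : commutative (@mul kunit).
Proof. by move=> a b; apply: val_inj; exact: mulrC. Qed.
HB.instance Definition _ := Group_isCommutative.Build kunit kunit_mulC.

End Units.

(* Hom(G, A) for A abelian, a group under the pointwise product inherited from
   {ffun G -> A}. *)
Section GHom.
Variables (G : finGroupType) (A : comGroupType).

Definition is_hom : pred {ffun G -> A} :=
  fun f => [forall x, [forall y, f (x * y) == f x * f y]].

Lemma is_homP (f : {ffun G -> A}) :
  reflect {morph f : x y / x * y} (is_hom f).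
Proof.
apply: (iffP forallP) => [fM x y | fM x].
  exact/eqP/(forallP (fM x)).
by apply/forallP => y; apply/eqP.
Qed.

Record ghom := GHom { hom_val : {ffun G -> A}; _ : is_hom hom_val }.
HB.instance Definition _ := [isSub for hom_val].
HB.instance Definition _ := [Choice of ghom by <:].
Definition hom_fun (f : ghom) : G -> A := hom_val f.
Coercion hom_fun : ghom >-> Funclass.

Lemma homM (f : ghom) : {morph f : x y / x * y}.
Proof. exact/is_homP/(valP f). Qed.

Fact is_hom_group_closed : group_closed is_hom.
Proof.
split=> [|f g /is_homP fM /is_homP gM]; apply/is_homP=> x y; rewrite !ffunE.
  by rewrite mulg1.
by rewrite fM gM invgM -!mulgA; congr (_ * _); rewrite mulgA comgC.
Qed.
HB.instance Definition _ := SubChoice_isSubGroup.Build _ _ ghom is_hom_group_closed.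

Lemma hom_mulE (f g : ghom) x : (f * g : ghom) x = f x * g x.
Proof. by rewrite /hom_fun /= ffunE. Qed.

Lemma homP (f g : ghom) : f =1 g <-> f = g.
Proof. by split=> [fg|->//]; apply/val_inj/ffunP. Qed.

Fact hom_mulC : commutative (@mul ghom).
Proof. by move=> f g; apply/homP=> x; rewrite !hom_mulE comgC. Qed.
HB.instance Definition _ := Group_isCommutative.Build ghom hom_mulC.

Definition mk_hom (f : G -> A) (fM : {morph f : x y / x * y}) : ghom.
Proof.
apply: (@GHom [ffun x => f x]).
by apply/is_homP => x y; rewrite !ffunE fM.
Defined.

Lemma mk_homE f fM : @mk_hom f fM =1 f.
Proof. by move=> x; rewrite /hom_fun /= ffunE. Qed.
End GHom.

Definition dual_group (k : fieldType) (G : finGroupType) : comGroupType :=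
  ghom G (kunit k).

(* Aut(G) with the usual composition (v * w) g = v (w g); the product of
   {perm G} composes in the opposite order. *)
Section GroupAut.
Variable G : finGroupType.

Record gaut := GAut { gaut_val : {perm G}; _ : gaut_val \in Aut [set: G] }.
HB.instance Definition _ := [isSub for gaut_val].
HB.instance Definition _ := [Choice of gaut by <:].
Definition gaut_fun (v : gaut) : G -> G := gaut_val v.
Coercion gaut_fun : gaut >-> Funclass.

Fact gaut_mul_proof (v w : gaut) : gaut_val w * gaut_val v \in Aut [set: G].
Proof. by rewrite groupM ?(valP v) ?(valP w). Qed.
Fact gaut_inv_proof (v : gaut) : (gaut_val v)^-1 \in Aut [set: G].
Proof. by rewrite groupV (valP v). Qed.

Definition gaut_one := GAut (group1 (Aut_group [set: G])).
Definition gaut_mul v w := GAut (gaut_mul_proof v w).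
Definition gaut_inv v := GAut (gaut_inv_proof v).

Fact gaut_mulA : associative gaut_mul.
Proof. by move=> u v w; apply: val_inj; rewrite /= mulgA. Qed.
Fact gaut_mul1 : left_id gaut_one gaut_mul.
Proof. by move=> v; apply: val_inj; rewrite /= mulg1. Qed.
Fact gaut_1mul : right_id gaut_one gaut_mul.
Proof. by move=> v; apply: val_inj; rewrite /= mul1g. Qed.
Fact gaut_mulV : left_inverse gaut_one gaut_inv gaut_mul.
Proof. by move=> v; apply: val_inj; rewrite /= mulgV. Qed.
Fact gaut_Vmul : right_inverse gaut_one gaut_inv gaut_mul.
Proof. by move=> v; apply: val_inj; rewrite /= mulVg. Qed.
HB.instance Definition _ :=
  isGroup.Build gaut gaut_mulA gaut_mul1 gaut_1mul gaut_mulV gaut_Vmul.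

Lemma gautM (v : gaut) : {morph v : x y / x * y}.
Proof. by move=> x y; apply: (morphicP (Aut_morphic (valP v))); rewrite inE. Qed.
Lemma gaut_mulE (v w : gaut) x : (v * w : gaut) x = v (w x).
Proof. by rewrite /gaut_fun /= permM. Qed.
Lemma gaut1E x : (1 : gaut) x = x.
Proof. by rewrite /gaut_fun /= perm1. Qed.
End GroupAut.

Section Semidirect.
Variables (k : fieldType) (G : finGroupType).
Notation Ghat := (dual_group k G).
Notation homs := (ghom G Ghat).
Implicit Types (chi : Ghat) (r s : homs) (v w : gaut G).

Fact pull_proof chi v : {morph (fun x => chi (v x)) : x y / x * y}.
Proof. by move=> x y /=; rewrite gautM homM. Qed.
(* v^* chi = chi \o v *)
Definition pull v chi : Ghat := mk_hom (pull_proof chi v).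

Fact hom_act_proof r v : {morph (fun g => pull v (r (v g))) : x y / x * y}.
Proof.
move=> x y /=; rewrite gautM homM; apply/homP => z.
by rewrite hom_mulE !mk_homE hom_mulE.
Qed.
(* r^v *)
Definition hom_act r v : homs := mk_hom (hom_act_proof r v).

Lemma hom_actE r v g h : hom_act r v g h = r (v g) (v h).
Proof. by rewrite /hom_act mk_homE mk_homE. Qed.

Lemma homs_eqP r s : (forall g h, r g h = s g h) -> r = s.
Proof. by move=> rs; apply/homP => g; apply/homP => h. Qed.

Lemma homs_mulE r s g h : (r * s : homs) g h = r g h * s g h.
Proof. by rewrite !hom_mulE. Qed.

Lemma hom_act1 r : hom_act r 1 = r.
Proof. by apply: homs_eqP => g h; rewrite hom_actE !gaut1E. Qed.
Lemma hom_actM r v w : hom_act r (v * w) = hom_act (hom_act r v) w.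
Proof. by apply: homs_eqP => g h; rewrite !hom_actE !gaut_mulE. Qed.
Lemma hom_act_mul r s v : hom_act (r * s) v = hom_act r v * hom_act s v.
Proof. by apply: homs_eqP => g h; rewrite homs_mulE !hom_actE homs_mulE. Qed.
Lemma hom_act_1 v : hom_act 1 v = 1.
Proof. by apply: (@mulgI _ (hom_act 1 v)); rewrite -hom_act_mul !mulg1. Qed.

(* (v, r) stands for the product v r *)
Record sdprod_group := SDProd { sd_aut : gaut G; sd_hom : homs }.

Definition sd_pair x := (sd_aut x, sd_hom x).
Definition pair_sd p := SDProd p.1 p.2.
Fact sd_pairK : cancel sd_pair pair_sd. Proof. by case. Qed.
HB.instance Definition _ := Choice.copy sdprod_group (can_type sd_pairK).

Definition sd_one := SDProd 1 1.
Definition sd_mul x y :=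
  SDProd (sd_aut x * sd_aut y) (hom_act (sd_hom x) (sd_aut y) * sd_hom y).
Definition sd_inv x :=
  SDProd (sd_aut x)^-1 (hom_act (sd_hom x) (sd_aut x)^-1)^-1.

Fact sd_mulA : associative sd_mul.
Proof.
by move=> x y z; rewrite /sd_mul /= hom_act_mul -hom_actM !mulgA.
Qed.
Fact sd_mul1 : left_id sd_one sd_mul.
Proof. by case=> v r; rewrite /sd_mul /= hom_act_1 !mul1g. Qed.
Fact sd_1mul : right_id sd_one sd_mul.
Proof. by case=> v r; rewrite /sd_mul /= hom_act1 !mulg1. Qed.
Fact sd_Vmul : right_inverse sd_one sd_inv sd_mul.
Proof. by case=> v r; rewrite /sd_mul /= !mulgV. Qed.
Fact sd_mulV : left_inverse sd_one sd_inv sd_mul.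
Proof.
case=> v r; rewrite /sd_mul /= mulVg; congr SDProd.
have V1: hom_act (hom_act r v^-1) v = r by rewrite -hom_actM mulVg hom_act1.
by apply: (mulgI r); rewrite mulg1 mulgA -{1}V1 -hom_act_mul mulgV hom_act_1 mul1g.
Qed.
HB.instance Definition _ :=
  isGroup.Build sdprod_group sd_mulA sd_mul1 sd_1mul sd_mulV sd_Vmul.
End Semidirect.

Local Open Scope ring_scope.

Section Drinfeld.
Variables (k : fieldType) (G : finGroupType).

(* The Drinfeld double D(G) in coordinates on the basis e_g # h. *)
Definition drinfeld := {ffun G * G -> k^o}.
HB.instance Definition _ := Vector.on drinfeld.

(* e_g # h *)
Definition dbase (p : G * G) : drinfeld := [ffun q => (p == q)%:R].

Definition dbase_mul (p q : G * G) : drinfeld :=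
  if p.1 == (p.2 * q.1 * p.2^-1)%g then dbase (p.1, p.2 * q.2)%g else 0.

Definition drinfeld_mul (x y : drinfeld) : drinfeld :=
  \sum_p \sum_q ((x p : k) * (y q : k)) *: dbase_mul p q.

Definition drinfeld_one : drinfeld := \sum_(g : G) dbase (g, 1%g).

Lemma drinfeldE (x : drinfeld) : x = \sum_p (x p : k) *: dbase p.
Proof.
have regE (a b : k) : a *: (b : k^o) = a * b by [].
apply/ffunP => q; rewrite sum_ffunE (bigD1 q) //= !ffunE eqxx regE mulr1.
by rewrite big1 ?addr0 // => p /negPf pq; rewrite !ffunE pq regE mulr0.
Qed.

Fact drinfeld_mulDl : left_distributive drinfeld_mul +%R.
Proof.
move=> x y z; rewrite /drinfeld_mul -big_split; apply: eq_bigr => p _ /=.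
rewrite -big_split; apply: eq_bigr => q _ /=.
by rewrite ffunE mulrDl scalerDl.
Qed.
Fact drinfeld_mulDr : right_distributive drinfeld_mul +%R.
Proof.
move=> x y z; rewrite /drinfeld_mul -big_split; apply: eq_bigr => p _ /=.
rewrite -big_split; apply: eq_bigr => q _ /=.
by rewrite ffunE mulrDr scalerDl.
Qed.
Fact drinfeld_scaleAl (a : k) (x y : drinfeld) :
  a *: drinfeld_mul x y = drinfeld_mul (a *: x) y.
Proof.
rewrite /drinfeld_mul scaler_sumr; apply: eq_bigr => p _.
by rewrite scaler_sumr; apply: eq_bigr => q _; rewrite scalerA ffunE mulrA.
Qed.
Fact drinfeld_scaleAr (a : k) (x y : drinfeld) :
  a *: drinfeld_mul x y = drinfeld_mul x (a *: y).
Proof.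
rewrite /drinfeld_mul scaler_sumr; apply: eq_bigr => p _.
by rewrite scaler_sumr; apply: eq_bigr => q _; rewrite scalerA ffunE mulrCA.
Qed.
Lemma drinfeld_mul_dbase p q : drinfeld_mul (dbase p) (dbase q) = dbase_mul p q.
Proof.
rewrite /drinfeld_mul (bigD1 p) //= (bigD1 q) //= big1 ?addr0; last first.
  by move=> q' /negPf qq; rewrite !ffunE (eq_sym q) qq mulr0 scale0r.
rewrite big1 ?addr0 ?ffunE ?eqxx ?mulr1 ?scale1r // => p' /negPf pp.
by rewrite big1 // => q' _; rewrite !ffunE (eq_sym p) pp mul0r scale0r.
Qed.
Fact drinfeld_mul0l y : drinfeld_mul 0 y = 0.
Proof. by apply: (addrI (drinfeld_mul 0 y)); rewrite -drinfeld_mulDl !addr0. Qed.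
Fact drinfeld_mul0r x : drinfeld_mul x 0 = 0.
Proof. by apply: (addrI (drinfeld_mul x 0)); rewrite -drinfeld_mulDr !addr0. Qed.
Lemma drinfeld_mul_suml I s (P : pred I) F y :
  drinfeld_mul (\sum_(i <- s | P i) F i) y = \sum_(i <- s | P i) drinfeld_mul (F i) y.
Proof.
exact: (big_morph (drinfeld_mul^~ y) (fun a b => drinfeld_mulDl a b y) (drinfeld_mul0l y)).
Qed.
Lemma drinfeld_mul_sumr I s (P : pred I) F x :
  drinfeld_mul x (\sum_(i <- s | P i) F i) = \sum_(i <- s | P i) drinfeld_mul x (F i).
Proof.
exact: (big_morph (drinfeld_mul x) (drinfeld_mulDr x) (drinfeld_mul0r x)).
Qed.
Fact dbase_mulA p q r :
  drinfeld_mul (dbase p) (dbase_mul q r) = drinfeld_mul (dbase_mul p q) (dbase r).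
Proof.
case: p q r => [a b] [c d] [e f]; rewrite /dbase_mul /=.
have J: (b * c * b^-1 == b * d * e * (b * d)^-1)%g = (c == d * e * d^-1)%g.
  by rewrite -[RHS](inj_eq (mulgI b)) -(inj_eq (mulIg b^-1%g)) invMg !mulgA.
have [cE|cd] := ifP; have [aE|ab] := ifP;
  rewrite ?drinfeld_mul0l ?drinfeld_mul0r ?drinfeld_mul_dbase // /dbase_mul /= ?aE ?ab //.
- by rewrite (eqP aE) J cE mulgA.
- by rewrite (eqP aE) J cd.
Qed.
Fact drinfeld_mulA : associative drinfeld_mul.
Proof.
move=> x y z; rewrite (drinfeldE x) (drinfeldE y) (drinfeldE z).
rewrite [LHS]drinfeld_mul_suml [X in _ = drinfeld_mul X _]drinfeld_mul_suml.
rewrite [RHS]drinfeld_mul_suml; apply: eq_bigr => p _.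
rewrite [X in drinfeld_mul _ X = _]drinfeld_mul_suml [LHS]drinfeld_mul_sumr.
rewrite [X in _ = drinfeld_mul X _]drinfeld_mul_sumr [RHS]drinfeld_mul_suml.
apply: eq_bigr => q _.
rewrite [X in drinfeld_mul _ X = _]drinfeld_mul_sumr [LHS]drinfeld_mul_sumr.
rewrite [RHS]drinfeld_mul_sumr; apply: eq_bigr => r _.
rewrite -!(drinfeld_scaleAl, drinfeld_scaleAr) !drinfeld_mul_dbase dbase_mulA.
by rewrite !scalerA; congr (_ *: _); rewrite -[RHS]mulrA [RHS]mulrC ?mulrA.
Qed.
Fact drinfeld_mul1 : left_id drinfeld_one drinfeld_mul.
Proof.
move=> x; rewrite {1 2}(drinfeldE x) /drinfeld_one drinfeld_mul_sumr.
apply: eq_bigr => -[g h] _; rewrite -drinfeld_scaleAr; congr (_ *: _).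
rewrite drinfeld_mul_suml (bigD1 g) //= drinfeld_mul_dbase /dbase_mul /=.
rewrite invg1 mulg1 !mul1g eqxx big1 ?addr0 // => a /negPf ag.
by rewrite drinfeld_mul_dbase /dbase_mul /= invg1 mulg1 mul1g ag.
Qed.
Fact drinfeld_1mul : right_id drinfeld_one drinfeld_mul.
Proof.
move=> x; rewrite {1 2}(drinfeldE x) /drinfeld_one drinfeld_mul_suml.
apply: eq_bigr => -[g h] _; rewrite -drinfeld_scaleAl; congr (_ *: _).
rewrite drinfeld_mul_sumr (bigD1 (h^-1 * g * h)%g) //= drinfeld_mul_dbase /dbase_mul /=.
rewrite !mulgA mulgV mul1g mulgK eqxx mulg1 big1 ?addr0 // => a ag.
rewrite drinfeld_mul_dbase /dbase_mul /= mulg1; case: eqP => // ga.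
by case/eqP: ag; rewrite ga !mulgA mulVg mul1g mulgKV.
Qed.
Fact drinfeld_one_neq0 : drinfeld_one != 0.
Proof.
apply/eqP => /ffunP /(_ (1%g, 1%g)) /eqP.
rewrite sum_ffunE (bigD1 1%g) //= !ffunE eqxx big1 ?addr0 ?oner_eq0 //.
by move=> g /negPf g1; rewrite !ffunE xpair_eqE g1.
Qed.

HB.instance Definition _ := GRing.Zmodule_isNzRing.Build drinfeld
  drinfeld_mulA drinfeld_mul1 drinfeld_1mul drinfeld_mulDl drinfeld_mulDr drinfeld_one_neq0.
HB.instance Definition _ := GRing.Lmodule_isLalgebra.Build k drinfeld drinfeld_scaleAl.
HB.instance Definition _ := GRing.Lalgebra_isAlgebra.Build k drinfeld drinfeld_scaleAr.

(* D(G) (x) D(G), on the basis (e_g # h) (x) (e_g' # h') indexed by pairs. *)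
Definition drinfeld2 := {ffun (G * G) * (G * G) -> k^o}.
HB.instance Definition _ := Vector.on drinfeld2.

Definition tens (x y : drinfeld) : drinfeld2 := [ffun p => (x p.1 : k) * (y p.2 : k)].

(* f (x) f, for f linear *)
Definition tens_map (f : drinfeld -> drinfeld) (t : drinfeld2) : drinfeld2 :=
  \sum_p (t p : k) *: tens (f (dbase p.1)) (f (dbase p.2)).

(* The coproduct of (k^G)^cop (x) kG:
   e_g # h |-> \sum_(a b = g) (e_b # h) (x) (e_a # h). *)
Definition comul (x : drinfeld) : drinfeld2 :=
  \sum_p (x p : k) *:
    \sum_(ab : G * G | (ab.1 * ab.2)%g == p.1)
      tens (dbase (ab.2, p.2)) (dbase (ab.1, p.2)).

(* e_g # h |-> delta_(g, 1) *)
Definition counit (x : drinfeld) : k := \sum_(h : G) x (1%g, h).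

(* S(e_g # h) = (eps # h^-1) (e_(g^-1) # 1) *)
Definition antipode (x : drinfeld) : drinfeld :=
  \sum_p (x p : k) *: dbase (p.2^-1 * p.1^-1 * p.2, p.2^-1)%g.

Lemma sum_dbase (V : lmodType k) (F : G * G -> V) p :
  \sum_q (dbase p q : k) *: F q = F p.
Proof.
rewrite (bigD1 p) //= ffunE eqxx scale1r big1 ?addr0 // => q.
by rewrite eq_sym ffunE => /negPf->; rewrite scale0r.
Qed.

Lemma dbaseM g g' h h' :
  dbase (g, g') * dbase (h, h')
    = if g == (g' * h * g'^-1)%g then dbase (g, g' * h')%g else 0.
Proof. exact: drinfeld_mul_dbase. Qed.

Lemma drinfeld1E : 1 = \sum_(g : G) dbase (g, 1%g).
Proof. by []. Qed.

Lemma comul_dbase g h :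
  comul (dbase (g, h)) = \sum_(ab : G * G | (ab.1 * ab.2)%g == g)
    tens (dbase (ab.2, h)) (dbase (ab.1, h)).
Proof. exact: sum_dbase. Qed.

Lemma antipode_dbase g h :
  antipode (dbase (g, h)) = dbase (h^-1 * g^-1 * h, h^-1)%g.
Proof. exact: sum_dbase. Qed.

Lemma counit_dbase g h : counit (dbase (g, h)) = (g == 1%g)%:R.
Proof.
rewrite /counit (bigD1 h) //= ffunE xpair_eqE eqxx andbT big1 ?addr0 // => h' h'h.
by rewrite ffunE xpair_eqE [h == _]eq_sym (negPf h'h) andbF.
Qed.

(* m (S (x) id) Delta = eta counit and m (id (x) S) Delta = eta counit on the
   basis *)
Lemma antipodeL g h :
  \sum_(ab : G * G | (ab.1 * ab.2)%g == g)
    antipode (dbase (ab.2, h)) * dbase (ab.1, h) = counit (dbase (g, h)) *: 1.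
Proof.
rewrite counit_dbase (reindex_onto (fun b => (g * b^-1, b)%g) snd) /=; last first.
  by move=> [a b] /= /eqP <-; rewrite mulgK.
rewrite (eq_bigl xpredT) => [|b]; last by rewrite mulgKV !eqxx.
have [->|g1] := eqVneq g 1%g.
  rewrite scale1r drinfeld1E [RHS](reindex_inj (inj_comp (conjg_inj h) invg_inj)) /=.
  apply: eq_bigr => b _; rewrite antipode_dbase dbaseM invgK mul1g eqxx mulVg.
  by rewrite conjgE mulgA.
rewrite scale0r big1 // => b _; rewrite antipode_dbase dbaseM invgK.
case: eqP => // /mulIg /mulgI.
by rewrite -[LHS]mul1g => /mulIg g1'; rewrite -g1' eqxx in g1.
Qed.

Lemma antipodeR g h :
  \sum_(ab : G * G | (ab.1 * ab.2)%g == g)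
    dbase (ab.2, h) * antipode (dbase (ab.1, h)) = counit (dbase (g, h)) *: 1.
Proof.
rewrite counit_dbase (reindex_onto (fun b => (g * b^-1, b)%g) snd) /=; last first.
  by move=> [a b] /= /eqP <-; rewrite mulgK.
rewrite (eq_bigl xpredT) => [|b]; last by rewrite mulgKV !eqxx.
have E b : (h * (h^-1 * (g * b^-1)^-1 * h) * h^-1 = b * g^-1)%g.
  by rewrite !mulgA mulgV mul1g mulgK invMg invgK.
have [gE|g1] := eqVneq g 1%g.
  rewrite scale1r drinfeld1E; apply: eq_bigr => b _.
  by rewrite antipode_dbase dbaseM E gE invg1 mulg1 eqxx mulgV.
rewrite scale0r big1 // => b _; rewrite antipode_dbase dbaseM E.
by rewrite -[X in X == _]mulg1 (inj_eq (mulgI b)) eq_sym invg_eq1 (negPf g1).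
Qed.

Lemma counitL g h :
  \sum_(ab : G * G | (ab.1 * ab.2)%g == g)
    counit (dbase (ab.2, h)) *: dbase (ab.1, h) = dbase (g, h).
Proof.
rewrite (bigD1 (g, 1%g)) /= ?mulg1 // counit_dbase eqxx scale1r big1 ?addr0 //.
move=> [a b] /= /andP[/eqP <-]; rewrite counit_dbase.
by have [->|_] := eqVneq b 1%g; rewrite ?scale0r // mulg1 eqxx.
Qed.

Lemma counitR g h :
  \sum_(ab : G * G | (ab.1 * ab.2)%g == g)
    counit (dbase (ab.1, h)) *: dbase (ab.2, h) = dbase (g, h).
Proof.
rewrite (bigD1 (1%g, g)) /= ?mul1g // counit_dbase eqxx scale1r big1 ?addr0 //.
move=> [a b] /= /andP[/eqP <-]; rewrite counit_dbase.
by have [->|_] := eqVneq a 1%g; rewrite ?scale0r // mul1g eqxx.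
Qed.
End Drinfeld.

Arguments dbase {k G} p.

Section HopfAut.
Variables (k : fieldType) (G : finGroupType).
Notation D := (drinfeld k G).

Definition is_hopf_aut (f : 'End(D)) : Prop :=
  [/\ bijective f,
      GRing.monoid_morphism f,
      forall x, comul (f x) = tens_map f (comul x),
      forall x, counit (f x) = counit x
    & forall x, f (antipode x) = antipode (f x)].

Record hopf_aut := HopfAut {
  hopf_aut_val : 'End(D);
  _ : `[< is_hopf_aut hopf_aut_val >] }.
HB.instance Definition _ := [isSub for hopf_aut_val].
HB.instance Definition _ := [Choice of hopf_aut by <:].
Definition hopf_aut_fun (f : hopf_aut) : D -> D := hopf_aut_val f.
Coercion hopf_aut_fun : hopf_aut >-> Funclass.

Lemma hopf_autP (f : hopf_aut) : is_hopf_aut (hopf_aut_val f).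
Proof. exact/asboolP/(valP f). Qed.

Lemma tens_map_tens (f : 'End(D)) x y :
  tens_map f (tens x y) = tens (f x) (f y).
Proof.
have fE (z : D) r : f z r = \sum_p (z p : k) * (f (dbase p) r : k).
  rewrite {1}[z]drinfeldE linear_sum sum_ffunE; apply: eq_bigr => p _.
  by rewrite linearZ ffunE.
apply/ffunP => r; rewrite /tens_map sum_ffunE ffunE !fE big_distrlr /= pair_big /=.
by apply: eq_bigr => p _; rewrite !ffunE mulrACA.
Qed.

Lemma tens_map_sum (f : D -> D) I (F : I -> drinfeld2 k G) (a : I -> k) s (P : pred I) :
  tens_map f (\sum_(i <- s | P i) a i *: F i)
    = \sum_(i <- s | P i) a i *: tens_map f (F i).
Proof.
rewrite /tens_map; under [RHS]eq_bigr do rewrite scaler_sumr.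
rewrite [RHS]exchange_big /=.
apply: eq_bigr => p _; rewrite sum_ffunE scaler_suml.
by apply: eq_bigr => i _; rewrite scalerA ffunE.
Qed.

Lemma tens_map_comp (f g : 'End(D)) t :
  tens_map f (tens_map g t) = tens_map (f \o g)%VF t.
Proof.
rewrite {2}/tens_map tens_map_sum; apply: eq_bigr => p _.
by rewrite tens_map_tens !comp_lfunE.
Qed.

Lemma tens_map1 t : tens_map (\1%VF : 'End(D)) t = t.
Proof.
apply/ffunP => -[p q]; rewrite sum_ffunE (bigD1 (p, q)) //= !ffunE !id_lfunE !ffunE.
rewrite !eqxx big1 ?addr0 => [|[p' q']]; first by rewrite /GRing.scale /= !mulr1.
rewrite xpair_eqE negb_and !ffunE !id_lfunE !ffunE /= /GRing.scale /=.
by case/orP => /negPf->; rewrite ?mul0r ?mulr0.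
Qed.

Fact is_hopf_aut1 : is_hopf_aut \1%VF.
Proof.
split=> [||x|x|x]; rewrite ?id_lfunE ?tens_map1 //.
  by exists id => x; rewrite id_lfunE.
by split=> [|x y]; rewrite !id_lfunE.
Qed.
Fact is_hopf_autM f g : is_hopf_aut f -> is_hopf_aut g -> is_hopf_aut (f \o g)%VF.
Proof.
case=> f1 [f21 f2M] f3 f4 f5 [g1 [g21 g2M] g3 g4 g5].
split=> [||x|x|x]; rewrite ?comp_lfunE.
- by apply: (eq_bij (bij_comp f1 g1)) => x; rewrite comp_lfunE.
- by split=> [|x y]; rewrite !comp_lfunE ?g21 ?f21 ?g2M ?f2M.
- by rewrite f3 g3 tens_map_comp.
- by rewrite f4.
- by rewrite g5.
Qed.
Fact is_hopf_aut_ker f : is_hopf_aut f -> lker f == 0%VS.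
Proof. by case=> /bij_inj /lker0P. Qed.
Fact is_hopf_autV f : is_hopf_aut f -> is_hopf_aut (f^-1)%VF.
Proof.
move=> fH; have fker := is_hopf_aut_ker fH; have [f1 [f21 f2M] f3 f4 f5] := fH.
have fK : cancel f (f^-1)%VF by move=> x; rewrite lker0_lfunK.
have fV : cancel (f^-1)%VF f by move=> x; rewrite lker0_lfunVK.
split=> [||x|x|x].
- by exists f.
- by split=> [|x y]; apply: (can_inj fK); rewrite ?f2M !fV ?f21.
- by rewrite -{2}(fV x) f3 tens_map_comp lker0_compVf // tens_map1.
- by rewrite -{2}(fV x) f4.
- by apply: (can_inj fK); rewrite f5 !fV.
Qed.

Definition hopf_aut_one := HopfAut (introT (asboolP _) is_hopf_aut1).
Definition hopf_aut_mul (f g : hopf_aut) :=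
  HopfAut (introT (asboolP _) (is_hopf_autM (hopf_autP f) (hopf_autP g))).
Definition hopf_aut_inv (f : hopf_aut) :=
  HopfAut (introT (asboolP _) (is_hopf_autV (hopf_autP f))).

Fact hopf_aut_mulA : associative hopf_aut_mul.
Proof. by move=> f g h; apply: val_inj; exact: comp_lfunA. Qed.
Fact hopf_aut_mul1 : left_id hopf_aut_one hopf_aut_mul.
Proof. by move=> f; apply: val_inj; exact: comp_lfun1l. Qed.
Fact hopf_aut_1mul : right_id hopf_aut_one hopf_aut_mul.
Proof. by move=> f; apply: val_inj; exact: comp_lfun1r. Qed.
Fact hopf_aut_mulV : left_inverse hopf_aut_one hopf_aut_inv hopf_aut_mul.
Proof.
move=> f; apply: val_inj; apply: lker0_compVf.
exact: is_hopf_aut_ker (hopf_autP f).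
Qed.
Fact hopf_aut_Vmul : right_inverse hopf_aut_one hopf_aut_inv hopf_aut_mul.
Proof.
move=> f; apply: val_inj; apply: lker0_compfV.
exact: is_hopf_aut_ker (hopf_autP f).
Qed.
HB.instance Definition _ := isGroup.Build hopf_aut
  hopf_aut_mulA hopf_aut_mul1 hopf_aut_1mul hopf_aut_mulV hopf_aut_Vmul.

Lemma hopf_aut_mulE (f g : hopf_aut) x : (f * g)%g x = f (g x).
Proof. exact: comp_lfunE. Qed.

End HopfAut.

(* Main.v *)
(** An automorphism [f] of D(G) sends 1 # h to a group-like element, hence to
    r(h) # v(h) for a character r(h).  Since characters chi # 1 are central and
    Z(G) = 1, the endomorphism v is injective.  Composing with the inverse of the
    automorphism attached to (v, r), we may assume that f fixes every 1 # h.
    Let u : k^G -> kG and p : k^G -> k^G be the components of f on k^G.  The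
    coproduct gives f(e_g) = \sum_(ab = g) p(e_b) # u(e_a) = \sum_(ab = g) p(e_a) # u(e_b),
    and multiplying by the idempotent u(e_t) <> 0 shows that p(k^G), which is all
    of k^G because f is onto, consists of functions invariant under conjugation
    by t.  Thus t = 1 and f(e_g) = p(e_g) # 1, where p is dual to an automorphism W
    of G commuting with all conjugations; then x^-1 W(x) is central, so W = id. *)
From HB Require Import structures.
Require Import Defs.
From mathcomp Require Import all_boot all_algebra all_fingroup all_solvable.
From mathcomp Require Import boolp.
Import GRing.Theory.
Local Open Scope ring_scope.

Set Implicit Arguments.
Unset Strict Implicit.
Unset Printing Implicit Defensive.

(** * Coordinate formulas for the structure maps of D(G), and the elements [1 # h] *)

Section Coordinates.
Variables (k : fieldType) (G : finGroupType).
Notation D := (drinfeld k G).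
Implicit Types (x : D) (g h a b y : G).

Lemma scale_coordE (T : finType) (c : k) (F : {ffun T -> k^o}) t :
  (c *: F) t = c * (F t : k).
Proof. exact: ffunE. Qed.

Lemma add_coordE (T : finType) (F F' : {ffun T -> k^o}) t :
  (F + F') t = (F t : k) + (F' t : k).
Proof. exact: ffunE. Qed.

(** A twisted convolution: once the group part [t] of the left factor is chosen, both indices of the
    right factor are forced. *)
Lemma mul_coordE x (y : D) g h :
  (x * y) (g, h) = \sum_t (x (g, t) : k) * y ((t^-1 * g * t)%g, (t^-1 * h)%g).
Proof.
rewrite [LHS]sum_ffunE.
rewrite (eq_bigr (fun p : G * G => (p.1 == g)%:R * ((x (g, p.2) : k) *
  y ((p.2^-1 * g * p.2)%g, (p.2^-1 * h)%g)))); last first.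
  move=> [a t] _ /=; rewrite sum_ffunE.
  rewrite (bigD1 (t^-1 * a * t, t^-1 * h)%g) //= big1 ?addr0; last first.
    move=> [b s] ne; rewrite !ffunE /dbase_mul /=.
    case: eqP => [E|_]; last by rewrite ffunE scaler0.
    rewrite !ffunE xpair_eqE; case: (t * s =P h)%g => [E'|]; last by rewrite andbF scaler0.
    by case/eqP: ne; rewrite E -E' !mulgA !mulVg !mul1g mulgKV.
  rewrite !ffunE /dbase_mul /= !mulgA mulgV mul1g mulgK eqxx.
  rewrite mul1g ffunE xpair_eqE eqxx andbT [LHS]mulrC.
  by case: (a =P g) => [->|]; rewrite ?mul1r ?mul0r.
rewrite -(pair_bigA _ (fun a t => (a == g)%:R * ((x (g, t) : k) *
  y ((t^-1 * g * t)%g, (t^-1 * h)%g)))) /= (bigD1 g) //= eqxx.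
under eq_bigr do rewrite mul1r.
rewrite [X in _ + X]big1 ?addr0 // => a /negPf ->.
by rewrite big1 // => t _; rewrite mul0r.
Qed.

(** The index [b] sits in the left tensor factor although the product is [a * b]: this is the
    opposite coproduct on k^G. The delta on [h], [h'] says that group elements are group-like. *)
Lemma comul_coordE x a b h h' :
  comul x ((b, h), (a, h')) = (h == h')%:R * (x ((a * b)%g, h) : k).
Proof.
rewrite /comul sum_ffunE (eq_bigr (fun p : G * G => (p == (a * b, h)%g)%:R *
  ((h == h')%:R * (x ((a * b)%g, h) : k)))).
  rewrite (bigD1 (a * b, h)%g) //= eqxx mul1r big1 ?addr0 // => p /negPf ->.
  by rewrite mul0r.
move=> [c s] _; rewrite scale_coordE sum_ffunE /= xpair_eqE.
have [<-|ne] := eqVneq (a * b)%g c; last first.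
  rewrite mul0r big1 ?mulr0 // => -[d e] /= /eqP E.
  rewrite !ffunE !xpair_eqE /=; case: eqP => [eb|]; last by rewrite mul0r.
  case: (d =P a) => [da|]; last by rewrite mulr0.
  by case/eqP: ne; rewrite -E da eb.
rewrite (bigD1 (a, b)) //= big1 ?addr0; last first.
  move=> [d e] /andP[_]; rewrite !ffunE !xpair_eqE /=.
  by case: (e =P b) => _; case: (d =P a) => _ //= _; rewrite ?mul0r ?mulr0.
rewrite !ffunE !xpair_eqE !eqxx /=.
have [->|] := eqVneq s h; last by rewrite !mul0r mulr0.
by rewrite !mul1r [LHS]mulrC.
Qed.

Lemma tens_map_coprod (f : 'End(D)) g h :
  tens_map f (comul (dbase (g, h))) = \sum_(ab : G * G | (ab.1 * ab.2)%g == g)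
    tens (f (dbase (ab.2, h))) (f (dbase (ab.1, h))).
Proof.
rewrite comul_dbase.
under eq_bigr do rewrite -[tens _ _]scale1r.
by rewrite tens_map_sum; apply: eq_bigr => p _; rewrite scale1r tens_map_tens.
Qed.

Lemma sum_factor_r (V : nmodType) (F : G -> G -> V) g :
  \sum_(ab : G * G | (ab.1 * ab.2)%g == g) F ab.1 ab.2 = \sum_b F (g * b^-1)%g b.
Proof.
rewrite (reindex_onto (fun b => (g * b^-1, b)%g) snd) /=; last first.
  by move=> [a b] /= /eqP <-; rewrite mulgK.
by apply: eq_bigl => b; rewrite mulgKV !eqxx.
Qed.

Lemma sum_factor_l (V : nmodType) (F : G -> G -> V) g :
  \sum_(ab : G * G | (ab.1 * ab.2)%g == g) F ab.1 ab.2 = \sum_a F a (a^-1 * g)%g.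
Proof.
rewrite (reindex_onto (fun a => (a, a^-1 * g)%g) fst) /=; last first.
  by move=> [a b] /= /eqP <-; rewrite mulKg.
by apply: eq_bigl => b; rewrite mulKVg !eqxx.
Qed.

(** This is [1 # h], the copy of [h] inside D(G). *)
Definition group_elt h : D := \sum_g dbase (g, h).

Lemma group_eltE h a y : group_elt h (a, y) = (y == h)%:R.
Proof.
rewrite sum_ffunE (bigD1 a) //= big1 ?addr0 => [|b /negPf ne].
  by rewrite ffunE xpair_eqE eqxx eq_sym.
by rewrite ffunE xpair_eqE ne.
Qed.

Lemma group_elt1 : group_elt 1%g = 1.
Proof. by []. Qed.

Lemma mul_group_elt x h a y : (x * group_elt h) (a, y) = x (a, (y * h^-1)%g).
Proof.
rewrite mul_coordE (bigD1 (y * h^-1)%g) //= big1 ?addr0 => [|t ne].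
  by rewrite group_eltE invMg invgK mulgKV eqxx mulr1.
rewrite group_eltE; case: eqP => [E|]; last by rewrite mulr0.
by case/eqP: ne; rewrite -E invMg invgK mulKVg.
Qed.

Lemma group_elt_mul x h a y :
  (group_elt h * x) (a, y) = x ((h^-1 * a * h)%g, (h^-1 * y)%g).
Proof.
rewrite mul_coordE (bigD1 h) //= big1 ?addr0 => [|t /negPf ne].
  by rewrite group_eltE eqxx mul1r.
by rewrite group_eltE ne mul0r.
Qed.

Lemma group_eltM g h : group_elt (g * h)%g = group_elt g * group_elt h.
Proof.
by apply/ffunP => -[a y]; rewrite mul_group_elt !group_eltE -(inj_eq (mulIg h^-1%g)) mulgK.
Qed.

Lemma dbase_group_elt g h : dbase (g, h) = dbase (g, 1%g) * group_elt h :> D.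
Proof.
apply/ffunP => -[a y]; rewrite mul_group_elt !ffunE !xpair_eqE.
by rewrite -(inj_eq (mulIg h^-1%g) h y) mulgV.
Qed.

Lemma group_elt_dbase g h :
  group_elt h * dbase (g, 1%g) = dbase ((h * g * h^-1)%g, h) :> D.
Proof.
apply/ffunP => -[a y]; rewrite group_elt_mul !ffunE !xpair_eqE.
rewrite -(inj_eq (mulgI h^-1%g) h y) mulVg; congr (_ && _)%:R.
by rewrite -(inj_eq (mulgI h)) -(inj_eq (mulIg h^-1%g)) !mulgA mulgV mul1g mulgK.
Qed.

Lemma lfun_eq_dbase (V : vectType k) (f f' : 'Hom(D, V)) :
  (forall g h, f (dbase (g, h)) = f' (dbase (g, h))) -> f = f'.
Proof.
move=> ff'; apply/lfunP => x; rewrite (drinfeldE x) !linear_sum.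
by apply: eq_bigr => -[g h] _; rewrite !linearZ /= ff'.
Qed.

End Coordinates.

(** * Hopf automorphisms fixing every [1 # h] are trivial when the center is trivial *)

Lemma centerless_eq1 (G : finGroupType) (t : G) :
  'Z([set: G])%g = 1%g -> (forall g, (t * g = g * t)%g) -> t = 1%g.
Proof.
move=> hZ tC; apply/set1gP; rewrite -hZ; apply/centerP; split; first exact: in_setT.
by move=> g _; exact: tC.
Qed.

Section FixedGroupElements.
Variables (k : fieldType) (G : finGroupType).
Notation D := (drinfeld k G).
Variable f : 'End(D).
Hypotheses (fH : is_hopf_aut f) (f_group : forall h, f (group_elt k h) = group_elt k h).
Hypothesis hZ : 'Z([set: G])%g = 1%g.

Let m g : D := f (dbase (g, 1%g)).
(* [u] and [p] are the components k^G -> kG and k^G -> k^G of [f]. *)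
Let u g y : k := m g (1%g, y).
Let p g a : k := \sum_y (m g (a, y) : k).

Let fM : {morph f : x y / x * y}. Proof. by case: fH => _ []. Qed.

Let comul_m g a b h h' :
  (h == h')%:R * (m g ((a * b)%g, h) : k)
    = \sum_(cd : G * G | (cd.1 * cd.2)%g == g) (m cd.2 (b, h) : k) * (m cd.1 (a, h') : k).
Proof.
case: fH => _ _ fC _ _; rewrite -comul_coordE fC tens_map_coprod sum_ffunE.
by apply: eq_bigr => cd _; rewrite ffunE.
Qed.

(** In a tensor product coalgebra, projecting one leg of the coproduct to each factor recovers the
    element. Summing [comul_m] over [h] applies the counit of kG to the first leg; putting 1 for the
    other k^G index applies the counit of k^G to the second. *)
Let m_pu g a y :
  m g (a, y) = \sum_(cd : G * G | (cd.1 * cd.2)%g == g) p cd.2 a * u cd.1 y.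
Proof.
transitivity (\sum_h (h == y)%:R * (m g ((1 * a)%g, h) : k)).
  by rewrite (bigD1 y) //= eqxx mul1r mul1g big1 ?addr0 // => h /negPf->; rewrite mul0r.
under eq_bigr do rewrite comul_m.
by rewrite exchange_big /=; apply: eq_bigr => cd _; rewrite -mulr_suml.
Qed.

(** The same with the two legs exchanged. *)
Let m_up g a y :
  m g (a, y) = \sum_(cd : G * G | (cd.1 * cd.2)%g == g) p cd.1 a * u cd.2 y.
Proof.
transitivity (\sum_h (y == h)%:R * (m g ((a * 1)%g, y) : k)).
  rewrite (bigD1 y) //= eqxx mul1r mulg1 big1 ?addr0 // => h.
  by rewrite eq_sym => /negPf->; rewrite mul0r.
under eq_bigr do rewrite comul_m.
rewrite exchange_big /=; apply: eq_bigr => cd _.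
by rewrite -mulr_sumr mulrC.
Qed.

Let mM g g' : m g * m g' = (g == g')%:R *: m g.
Proof.
rewrite -fM dbaseM invg1 mulg1 !mul1g.
by have [->|_] := eqVneq g g'; rewrite ?scale1r // linear0 scale0r.
Qed.

(** Since 1 is fixed by conjugation, restricting the first coordinate to 1 is an algebra map from
    D(G) onto kG; it carries the orthogonal idempotents [m g] to the [u g]. *)
Let uM g g' y : \sum_t u g t * u g' (t^-1 * y)%g = (g == g')%:R * u g y.
Proof.
rewrite -[RHS]scale_coordE -mM mul_coordE; apply: eq_bigr => t _.
by rewrite mulg1 mulVg.
Qed.

(** Because [f] fixes [1 # h], it commutes with conjugation by it. The sum over the second
    coordinate absorbs the resulting translations. *)
Let p_conj g h a : p (h * g * h^-1)%g a = p g (h^-1 * a * h)%g.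
Proof.
have E : m (h * g * h^-1)%g * group_elt k h = group_elt k h * m g.
  by rewrite -(f_group h) -!fM -dbase_group_elt group_elt_dbase.
rewrite /p (reindex_inj (mulIg h^-1%g)) [RHS](reindex_inj (mulgI h^-1%g)) /=.
by apply: eq_bigr => y _; rewrite -mul_group_elt -group_elt_mul E.
Qed.

Let p_span x a : \sum_y (f x (a, y) : k) = \sum_(q : G * G) (x q : k) * p q.1 a.
Proof.
rewrite {1}(drinfeldE x) linear_sum /=; under eq_bigr do rewrite sum_ffunE.
rewrite exchange_big /=; apply: eq_bigr => -[g h] _ /=.
rewrite linearZ /= dbase_group_elt fM f_group -/(m g) /p [RHS]mulr_sumr.
rewrite [LHS](reindex_inj (mulIg h)) /=; apply: eq_bigr => y _.
by rewrite scale_coordE mul_group_elt mulgK.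
Qed.

(** As [f] is onto, [p_span] shows that the functions [p g] span k^G. The preimage of [e_b # 1]
    yields a combination of them that tells [b] from any other point. *)
Let p_separates a b : (forall g, p g a = p g b) -> a = b.
Proof.
move=> pab; have [[f' _ fK'] _ _ _ _] := fH.
have : \sum_y (f (f' (dbase (b, 1%g))) (a, y) : k)
     = \sum_y (f (f' (dbase (b, 1%g))) (b, y) : k).
  by rewrite !p_span; apply: eq_bigr => q _; rewrite pab.
rewrite !fK' [RHS](bigD1 1%g) //= ffunE eqxx [in RHS]big1 ?addr0; last first.
  by move=> y /negPf ne; rewrite ffunE xpair_eqE eq_sym ne andbF.
move/eqP; apply: contraTeq => /negPf ne.
rewrite big1 ?(eq_sym 0) ?oner_eq0 // => y _.
by rewrite ffunE xpair_eqE eq_sym ne.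
Qed.

(* Both decompositions of [m g] agree since the coalgebra of the double is a
   tensor product; multiplying by the idempotent [u t] isolates one term. *)
Let p_shift t y g a : u t y != 0 -> p (t^-1 * g)%g a = p (g * t^-1)%g a.
Proof.
move=> ut; apply: (mulIf ut).
(* For fixed [a], this is the convolution in kG of [m g (a, _)] with [u t], evaluated at [y]. It is
   expanded by [m_pu] and then by [m_up]; each time [uM] leaves one term. *)
transitivity (\sum_s (m g (a, s) : k) * u t (s^-1 * y)%g).
  under [RHS]eq_bigr do
    rewrite m_pu (sum_factor_l (fun c d => p d a * u c _)) mulr_suml.
  rewrite exchange_big /= (bigD1 t) //= [X in _ + X]big1 ?addr0; last first.
    move=> c /negPf ne; under eq_bigr do rewrite -mulrA.
    by rewrite -mulr_sumr uM ne mul0r mulr0.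
  under eq_bigr do rewrite -mulrA.
  by rewrite -mulr_sumr uM eqxx mul1r.
under eq_bigr do rewrite m_up (sum_factor_r (fun c d => p c a * u d _)) mulr_suml.
rewrite exchange_big /= (bigD1 t) //= [X in _ + X]big1 ?addr0; last first.
  move=> c /negPf ne; under eq_bigr do rewrite -mulrA.
  by rewrite -mulr_sumr uM ne mul0r mulr0.
under eq_bigr do rewrite -mulrA.
by rewrite -mulr_sumr uM eqxx mul1r.
Qed.

Let u_supp t y : t != 1%g -> u t y = 0.
Proof.
move=> t1; apply/eqP; apply: contraNT t1 => ut; apply/eqP/(centerless_eq1 hZ) => a.
have E : (t^-1 * a * t)%g = a.
  (* [p_shift] at [t * g] in place of [g] becomes invariance under conjugation by [t]. *)
  by apply: p_separates => g; rewrite -p_conj -[in RHS](mulKg t g) (p_shift _ _ ut).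
by rewrite -{1}E !mulgA mulgV mul1g.
Qed.

Let sum_m : \sum_g m g = 1.
Proof.
by case: fH => _ [f1 _] _ _ _; rewrite -f1 -linear_sum; congr (f _).
Qed.

(** The [u g] add up to the unit of kG, and only [u 1] survives. *)
Let u1 y : u 1%g y = (y == 1%g)%:R.
Proof.
rewrite -(group_eltE k 1%g 1%g y) group_elt1 -sum_m sum_ffunE.
by rewrite (bigD1 1%g) //= big1 ?addr0 // => g; exact: u_supp.
Qed.

Let mE g a y : m g (a, y) = (y == 1%g)%:R * p g a.
Proof.
rewrite m_up (sum_factor_r (fun c d => p c a * u d _)) (bigD1 1%g) //=.
by rewrite u1 invg1 mulg1 mulrC big1 ?addr0 // => t /u_supp ->; rewrite mulr0.
Qed.

Let pM g g' a : p g a * p g' a = (g == g')%:R * p g a.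
Proof.
have := congr1 (fun x : D => x (a, 1%g)) (mM g g').
rewrite scale_coordE mul_coordE mE eqxx mul1r (bigD1 1%g) //=.
rewrite !mE !eqxx invg1 !mul1g mulg1 eqxx !mul1r big1 ?addr0 // => t /negPf ne.
by rewrite mE ne !mul0r.
Qed.

Let sum_p a : \sum_g p g a = 1.
Proof.
have := congr1 (fun x : D => x (a, 1%g)) sum_m.
rewrite -group_elt1 group_eltE eqxx sum_ffunE => E; apply: etrans E.
by apply: eq_bigr => g _; rewrite mE eqxx mul1r.
Qed.

Let p_comul g a b :
  p g (a * b)%g = \sum_(cd : G * G | (cd.1 * cd.2)%g == g) p cd.2 b * p cd.1 a.
Proof.
have := comul_m g a b 1%g 1%g; rewrite mE !eqxx !mul1r => ->.
by apply: eq_bigr => cd _; rewrite !mE !eqxx !mul1r.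
Qed.

(** For fixed [a], [pM] and [sum_p] make the scalars [p g a] orthogonal idempotents of a field with
    sum 1, so exactly one is nonzero. The default is never reached. *)
Let W a := odflt 1%g [pick w | p w a != 0].

Let pW g a : p g a = (g == W a)%:R.
Proof.
rewrite /W; case: pickP => [w pw|p0] /=; last first.
  move/eqP: (sum_p a); rewrite big1 ?(eq_sym 0) ?oner_eq0 // => h _.
  by apply/eqP; rewrite -[_ == _]negbK p0.
have pw1 : p w a = 1 by apply: (mulfI pw); rewrite pM eqxx mul1r mulr1.
have [->//|ne] := eqVneq g w.
by apply: (mulIf pw); rewrite pM (negPf ne) !mul0r.
Qed.

Let W_eq g a : p g a != 0 -> g = W a.
Proof. by rewrite pW; case: (g =P W a) => // _; rewrite mulr0n eqxx. Qed.

Let W_morph : {morph W : a b / (a * b)%g}.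
Proof.
move=> a b; apply/esym/W_eq.
rewrite p_comul (bigD1 (W a, W b)) //= !pW !eqxx mulr1 big1 ?addr0 ?oner_eq0 //.
move=> [c d] /andP[_]; rewrite xpair_eqE !pW /=.
by case: (c == W a) => /= [/negPf->|_]; rewrite ?mul0r ?mulr0.
Qed.

Let W_conj h a : W (h * a * h^-1)%g = (h * W a * h^-1)%g.
Proof. by apply/esym/W_eq; rewrite p_conj !mulgA mulVg mul1g mulgKV pW eqxx oner_eq0. Qed.

Let W_inj : injective W.
Proof. by move=> a b ab; apply: p_separates => g; rewrite !pW ab. Qed.

Let W_id a : W a = a.
Proof.
apply/eqP; rewrite eq_sym eq_mulVg1; apply/eqP/(centerless_eq1 hZ) => b.
(* An injective [W] on a finite group is onto, so [b] is [W c]. Computing [W] of [a * c * a^-1] by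
   [W_morph] and by [W_conj] shows that [a^-1 * W a] commutes with it. *)
rewrite -(f_invF W_inj b); set c := invF _ b.
have : (W a * W c * W a^-1 = a * W c * a^-1)%g by rewrite -!W_morph W_conj.
have WV : (W a^-1 = (W a)^-1)%g.
  apply: (mulgI (W a)); rewrite mulgV -W_morph mulgV.
  by apply: (mulgI (W 1%g)); rewrite -W_morph !mulg1.
rewrite WV => E; apply: (mulgI a).
by rewrite !mulgA mulgV mul1g -E mulgKV.
Qed.

Lemma hopf_aut_fixing_group : f = \1%VF.
Proof.
apply: lfun_eq_dbase => g h; rewrite id_lfunE dbase_group_elt fM f_group -/(m g).
congr (_ * _); apply/ffunP => -[a y].
by rewrite mE pW W_id ffunE xpair_eqE -natrM mulnb andbC [y == _]eq_sym.
Qed.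
End FixedGroupElements.

(** * Elementary facts on characters and group automorphisms *)

Section GroupHom.
Variables (k : fieldType) (G : finGroupType) (A : comGroupType).

Lemma kunit_valM (a b : kunit k) : kunit_val (a * b)%g = kunit_val a * kunit_val b.
Proof. by []. Qed.

Lemma ghom1 (f : ghom G A) : f 1%g = 1%g.
Proof. by apply: (@mulgI _ (f 1%g)); rewrite -homM !mulg1. Qed.

Lemma ghom_oneE g : (1%g : ghom G A) g = 1%g.
Proof. by rewrite /hom_fun /= ffunE. Qed.

Lemma ghom_conj (f : ghom G A) g t : f (t^-1 * g * t)%g = f g.
Proof. by rewrite !homM comgC mulgA -homM mulgV ghom1 mul1g. Qed.

Lemma gaut_inj (v : gaut G) : injective v.
Proof. exact: perm_inj. Qed.

Lemma gautVK (v : gaut G) : cancel v (v^-1)%g.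
Proof. by move=> g; rewrite -gaut_mulE mulVg gaut1E. Qed.

Lemma gaut1 (v : gaut G) : v 1%g = 1%g.
Proof. by apply: (@mulgI _ (v 1%g)); rewrite -gautM !mulg1. Qed.

Lemma gautV (v : gaut G) g : v g^-1%g = (v g)^-1%g.
Proof. by apply: (@mulgI _ (v g)); rewrite -gautM !mulgV gaut1. Qed.

Fact gaut_of_proof (V : G -> G) (V_inj : injective V) :
  {morph V : x y / (x * y)%g} -> perm V_inj \in Aut [set: G].
Proof.
move=> VM; rewrite inE; apply/andP; split; first by apply/subsetP => x _; rewrite inE.
by apply/morphicP => x y _ _; rewrite !permE VM.
Qed.
Definition gaut_of V V_inj VM : gaut G := GAut (@gaut_of_proof V V_inj VM).

Lemma gaut_ofE V V_inj VM : @gaut_of V V_inj VM =1 V.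
Proof. by move=> g; rewrite /gaut_fun /= permE. Qed.
End GroupHom.

(** * The action of the semidirect product on D(G) by Hopf automorphisms *)

Section SemidirectAction.
Variables (k : fieldType) (G : finGroupType).
Notation D := (drinfeld k G).
Implicit Types (s t : sdprod_group k G) (v : gaut G) (x y : D) (g h : G).

Definition sd_coef s h g : k := kunit_val (sd_hom s h g).

Lemma sd_coef_neq0 s h g : sd_coef s h g != 0.
Proof. exact: kunit_neq0. Qed.

Lemma sd_coef1l s g : sd_coef s 1%g g = 1.
Proof. by rewrite /sd_coef ghom1 ghom_oneE. Qed.

Lemma sd_coef1r s h : sd_coef s h 1%g = 1.
Proof. by rewrite /sd_coef ghom1. Qed.

Lemma sd_coefMl s h h' g : sd_coef s (h * h')%g g = sd_coef s h g * sd_coef s h' g.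
Proof. by rewrite /sd_coef homM hom_mulE. Qed.

Lemma sd_coefMr s h g g' : sd_coef s h (g * g')%g = sd_coef s h g * sd_coef s h g'.
Proof. by rewrite /sd_coef homM. Qed.

Lemma sd_coef_conj s h g a : sd_coef s h (a^-1 * g * a)%g = sd_coef s h g.
Proof. by rewrite /sd_coef ghom_conj. Qed.

(** The coefficient is multiplicative in each argument, so the two inversions cancel. This is what
    the antipode needs. *)
Lemma sd_coefV s h g : sd_coef s h^-1%g g^-1%g = sd_coef s h g.
Proof.
have hV : sd_coef s h^-1%g g * sd_coef s h g = 1 by rewrite -sd_coefMl mulVg sd_coef1l.
apply: (mulfI (sd_coef_neq0 s h^-1%g g)).
by rewrite hV -sd_coefMr mulgV sd_coef1r.
Qed.

(** On the basis, with [s] the pair (v, r), this sends [e_g # h] to [r(h)(g) e_(v g) # v h]: first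
    [r] acts, then [v]. Coordinates transform through the inverse, so the local [v] is that
    inverse. *)
Definition sd_map s x : D :=
  [ffun q => let v := (sd_aut s)^-1%g in sd_coef s (v q.2) (v q.1) * (x (v q.1, v q.2) : k)].

Fact sd_map_linear s : linear (sd_map s).
Proof.
move=> a x y; apply/ffunP => q; rewrite add_coordE scale_coordE !ffunE /= add_coordE scale_coordE.
by rewrite mulrDr [in LHS]mulrCA.
Qed.
HB.instance Definition _ s :=
  GRing.isLinear.Build k D D *:%R (sd_map s) (sd_map_linear s).

Definition sd_lfun s : 'End(D) := linfun (sd_map s).

Lemma sd_lfun_coordE s x g h :
  sd_lfun s x (sd_aut s g, sd_aut s h) = sd_coef s h g * (x (g, h) : k).
Proof. by rewrite lfunE /= ffunE /= !gautVK. Qed.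

Lemma gaut_coordP v x y : (forall g h, x (v g, v h) = y (v g, v h)) -> x = y.
Proof.
move=> xy; apply/ffunP => -[a b].
by rewrite -[a](f_invF (@gaut_inj _ v)) -[b](f_invF (@gaut_inj _ v)) xy.
Qed.

Lemma sd_lfun_dbase s g h :
  sd_lfun s (dbase (g, h)) = sd_coef s h g *: dbase (sd_aut s g, sd_aut s h).
Proof.
apply: (@gaut_coordP (sd_aut s)) => a b; rewrite sd_lfun_coordE scale_coordE !ffunE.
rewrite !xpair_eqE !(inj_eq (@gaut_inj _ _)).
by have [->|] := eqVneq g a; have [->|] := eqVneq h b; rewrite ?mulr0.
Qed.

Lemma sd_lfun1 : sd_lfun 1%g = \1%VF.
Proof.
apply: lfun_eq_dbase => g h; rewrite sd_lfun_dbase id_lfunE /sd_coef /= !gaut1E.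
by rewrite !ghom_oneE scale1r.
Qed.

(** The character part of [s] is evaluated after both indices have been moved by [sd_aut t], which
    is exactly the right action [hom_act]. *)
Lemma sd_lfunM s t : sd_lfun (s * t)%g = (sd_lfun s \o sd_lfun t)%VF.
Proof.
apply: lfun_eq_dbase => g h; rewrite comp_lfunE !sd_lfun_dbase linearZ /=.
rewrite sd_lfun_dbase scalerA /= !gaut_mulE; congr (_ *: _).
by rewrite /sd_coef /= homs_mulE hom_actE kunit_valM [LHS]mulrC.
Qed.

Lemma sd_lfun_bij s : bijective (sd_lfun s).
Proof.
exists (sd_lfun s^-1%g) => x; rewrite -comp_lfunE -sd_lfunM ?mulVg ?mulgV sd_lfun1.
  by rewrite id_lfunE.
by rewrite id_lfunE.
Qed.

(** For a fixed group part [h] the scalar is a character of the k^G index; for distinct group parts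
    both sides vanish. *)
Lemma sd_lfun_comul s x : comul (sd_lfun s x) = tens_map (sd_lfun s) (comul x).
Proof.
pose v := sd_aut s.
have tensE (y : drinfeld2 k G) b h a h' : tens_map (sd_lfun s) y ((v b, v h), (v a, v h'))
    = sd_coef s h b * sd_coef s h' a * (y ((b, h), (a, h')) : k).
  rewrite /tens_map sum_ffunE (bigD1 ((b, h), (a, h'))) //= big1 ?addr0.
    rewrite scale_coordE ffunE /= !sd_lfun_coordE !ffunE !eqxx !mulr1.
    by rewrite [LHS]mulrC.
  move=> [[b1 h1] [a1 h1']] ne; rewrite scale_coordE ffunE /= !sd_lfun_coordE !ffunE.
  move: ne; rewrite xpair_eqE negb_and => /orP[] /negPf ->.
    by rewrite mulr0 mul0r mulr0.
  by rewrite !mulr0.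
apply/ffunP => -[[b h] [a h']].
rewrite -[b](f_invF (@gaut_inj _ v)) -[h](f_invF (@gaut_inj _ v)).
rewrite -[a](f_invF (@gaut_inj _ v)) -[h'](f_invF (@gaut_inj _ v)).
move: (invF _ b) (invF _ h) (invF _ a) (invF _ h') => {}b {}h {}a {}h'.
rewrite tensE !comul_coordE -gautM sd_lfun_coordE sd_coefMr (inj_eq (@gaut_inj _ _)).
have [->|_] := eqVneq h h'; last by rewrite !mul0r mulr0.
by rewrite !mul1r [sd_coef _ _ a * _]mulrC.
Qed.

(** The conjugation in the product is invisible to characters, and the scalars of the two factors
    multiply because [r] is a homomorphism. *)
Lemma sd_lfun_monoid s : GRing.monoid_morphism (sd_lfun s).
Proof.
split.
  apply: (@gaut_coordP (sd_aut s)) => g h; rewrite sd_lfun_coordE -group_elt1 !group_eltE.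
  rewrite -[in RHS](gaut1 (sd_aut s)) (inj_eq (@gaut_inj _ _)).
  by case: eqP => [->|]; rewrite ?mulr0 // sd_coef1l mulr1.
move=> x y; apply: (@gaut_coordP (sd_aut s)) => g h.
rewrite sd_lfun_coordE !mul_coordE mulr_sumr [RHS](reindex_inj (@gaut_inj _ (sd_aut s))) /=.
apply: eq_bigr => t _; rewrite -gautV -!gautM !sd_lfun_coordE sd_coef_conj.
by rewrite mulrACA -sd_coefMl mulKVg.
Qed.

Lemma sd_lfun_counit s x : counit (sd_lfun s x) = counit x.
Proof.
rewrite /counit (reindex_inj (@gaut_inj _ (sd_aut s))) /=.
apply: eq_bigr => h _; rewrite -[in LHS](gaut1 (sd_aut s)) sd_lfun_coordE.
by rewrite sd_coef1r mul1r.
Qed.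

Lemma antipode_coordE x g h : antipode x (g, h) = x ((h^-1 * g^-1 * h)%g, h^-1%g).
Proof.
rewrite /antipode sum_ffunE (bigD1 ((h^-1 * g^-1 * h)%g, h^-1%g)) //= big1 ?addr0.
  rewrite scale_coordE ffunE !invMg !invgK !mulgA mulgV mul1g mulgK eqxx.
  exact: mulr1.
move=> [a b] ne; rewrite scale_coordE ffunE xpair_eqE /=.
case: eqP => [ga|]; last by rewrite mulr0.
case: eqP => [hb|]; last by rewrite mulr0.
by case/eqP: ne; rewrite -ga -hb !invMg !invgK !mulgA mulgV mul1g mulgK.
Qed.

Lemma sd_lfun_antipode s x : sd_lfun s (antipode x) = antipode (sd_lfun s x).
Proof.
apply: (@gaut_coordP (sd_aut s)) => g h.
rewrite sd_lfun_coordE !antipode_coordE -!gautV -!gautM sd_lfun_coordE.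
by rewrite sd_coef_conj sd_coefV.
Qed.

Lemma sd_lfun_hopf s : is_hopf_aut (sd_lfun s).
Proof.
split; [exact: sd_lfun_bij | exact: sd_lfun_monoid | exact: sd_lfun_comul
  | exact: sd_lfun_counit | exact: sd_lfun_antipode].
Qed.

Definition sd_hopf s : hopf_aut k G := HopfAut (introT (asboolP _) (sd_lfun_hopf s)).

Lemma sd_hopfM : {morph sd_hopf : s t / (s * t)%g}.
Proof. by move=> s t; apply: val_inj; exact: sd_lfunM. Qed.
HB.instance Definition _ := isMultiplicative.Build _ _ sd_hopf sd_hopfM.

Lemma sd_lfun_inj : injective sd_lfun.
Proof.
move=> s t st.
(* The common image of [e_g # h] is read at the index where [s] places it. The scalar there is
   nonzero, so [t] must place it at the same index. *)
have E g h : sd_coef t h g * (dbase (sd_aut t g, sd_aut t h)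
    (sd_aut s g, sd_aut s h) : k) = sd_coef s h g.
  by rewrite -scale_coordE -sd_lfun_dbase -st sd_lfun_coordE ffunE eqxx mulr1.
have Ev g h : sd_aut t g = sd_aut s g /\ sd_coef t h g = sd_coef s h g.
  have := E g h; rewrite ffunE xpair_eqE; case: eqP => [-> /=|_ /= /eqP]; last first.
    by rewrite mulr0 eq_sym (negPf (sd_coef_neq0 _ _ _)).
  case: eqP => [_|_ /= /eqP]; first by rewrite mulr1.
  by rewrite mulr0 eq_sym (negPf (sd_coef_neq0 _ _ _)).
case: s t {st E} Ev => [v r] [w q] /= Ev; congr SDProd.
  by apply/val_inj/permP => g; have [] := Ev g 1%g.
by apply: homs_eqP => g h; apply: val_inj; have [] := Ev h g.
Qed.

End SemidirectAction.

(** * Images of the group-like elements [1 # h] under a Hopf automorphism *)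

Section GroupLikeImages.
Variables (k : fieldType) (G : finGroupType).
Notation D := (drinfeld k G).
Variable f : 'End(D).
Hypothesis fH : is_hopf_aut f.
Hypothesis hZ : 'Z([set: G])%g = 1%g.

Let x h : D := f (group_elt k h).

Let fM : {morph f : x y / x * y}. Proof. by case: fH => _ []. Qed.

Let xM g h : x (g * h)%g = x g * x h.
Proof. by rewrite -fM -group_eltM. Qed.

Let comul_group_elt (h : G) : comul (group_elt k h) = tens (group_elt k h) (group_elt k h).
Proof.
apply/ffunP => -[[b y] [a y']]; rewrite comul_coordE ffunE !group_eltE /=.
have [<-|ne] := eqVneq y y'; first by case: (y == h); rewrite !(mul1r, mul0r).
rewrite mul0r; have [e|_] := eqVneq y h; last by rewrite mul0r.
by rewrite -e eq_sym (negPf ne) mulr0.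
Qed.

Let x_like h a b y y' :
  (y == y')%:R * (x h ((a * b)%g, y) : k) = (x h (b, y) : k) * (x h (a, y') : k).
Proof.
case: fH => _ _ fC _ _.
by rewrite -comul_coordE fC comul_group_elt tens_map_tens ffunE.
Qed.

Let counit_x h : \sum_y (x h (1%g, y) : k) = 1.
Proof.
case: fH => _ _ _ fe _; rewrite -[LHS]/(counit (x h)) fe /counit (bigD1 h) //=.
by rewrite group_eltE eqxx big1 ?addr0 // => y /negPf ne; rewrite group_eltE ne.
Qed.

(** By [counit_x] some [y] qualifies, so the default is never reached; [x_like] at distinct group
    parts shows that [x h] lives on this [y] alone. Thus [x h] is [c h # V h] with [c h] a
    character. *)
Let V h := odflt 1%g [pick y | x h (1%g, y) != 0].
Let c h a : k := x h (a, V h).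

Let xV1 h : x h (1%g, V h) = 1.
Proof.
rewrite /V; case: pickP => [y ny|x0] /=; last first.
  move/eqP: (counit_x h); rewrite big1 ?(eq_sym 0) ?oner_eq0 // => y _.
  by apply/eqP; rewrite -[_ == _]negbK x0.
by apply: (mulfI ny); rewrite -x_like eqxx mul1r mulg1 mulr1.
Qed.

Let xE h a y : x h (a, y) = (y == V h)%:R * c h a.
Proof.
have [->|ne] := eqVneq y (V h); first by rewrite mul1r.
by rewrite mul0r -[LHS]mulr1 -(xV1 h) -x_like (negPf ne) mul0r.
Qed.

Let cMr h a b : c h (a * b)%g = c h a * c h b.
Proof. by rewrite [RHS]mulrC -x_like eqxx mul1r. Qed.

Let c_neq0 h a : c h a != 0.
Proof.
have : c h a * c h a^-1%g != 0 by rewrite -cMr mulgV /c xV1 oner_eq0.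
by apply: contraNneq => ->; rewrite mul0r.
Qed.

Let c_conj h a t : c h (t^-1 * a * t)%g = c h a.
Proof. by rewrite !cMr mulrAC -cMr mulVg {1}/c xV1 mul1r. Qed.

Let x_mulE h (y : D) a z : (x h * y) (a, z)
  = c h a * (y (((V h)^-1 * a * V h)%g, ((V h)^-1 * z)%g) : k).
Proof.
rewrite mul_coordE (bigD1 (V h)) //= big1 ?addr0 // => t /negPf ne.
by rewrite xE ne !mul0r.
Qed.

Let V_morph : {morph V : g h / (g * h)%g}.
Proof.
move=> g h; apply/eqP.
(* It suffices to find a nonzero coordinate with group part [V g * V h], since [xE] allows only one
   group part. *)
have : x (g * h)%g (1%g, (V g * V h)%g) != 0.
  by rewrite xM x_mulE mulKg mulf_neq0 ?c_neq0.
by rewrite xE; have [//|_] := eqVneq (V g * V h)%g (V (g * h)%g); rewrite mul0r eqxx.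
Qed.

Let cMl g h a : c (g * h)%g a = c g a * c h a.
Proof. by rewrite {1}/c V_morph xM x_mulE mulKg -/(c h _) c_conj. Qed.

(* If [V h = 1], then [x h] lies in k^G and is a character, hence central. *)
Let V_ker h : V h = 1%g -> h = 1%g.
Proof.
move=> Vh; apply: (centerless_eq1 hZ) => g.
have xC (y : D) : x h * y = y * x h.
  apply/ffunP => -[a z]; rewrite x_mulE Vh invg1 !mul1g mulg1.
  rewrite mul_coordE (bigD1 z) //= xE mulVg Vh eqxx mul1r c_conj mulrC.
  rewrite big1 ?addr0 // => t ne; rewrite xE Vh -eq_mulVg1 (negPf ne).
  by rewrite mul0r mulr0.
have [[f' fK _] _ _ _ _] := fH.
have : group_elt k h * dbase (g, 1%g) = dbase (g, 1%g) * group_elt k h.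
  by apply: (can_inj fK); rewrite !fM xC.
rewrite group_elt_dbase -dbase_group_elt => /ffunP /(_ (g, h)) /eqP.
rewrite !ffunE !xpair_eqE !eqxx andbT.
have [E _|_] := eqVneq (h * g * h^-1)%g g; last by rewrite eq_sym oner_eq0.
by rewrite -[in RHS]E mulgKV.
Qed.

Let V_inj : injective V.
Proof.
move=> g h gh; apply/esym/eqP; rewrite eq_mulVg1; apply/eqP/V_ker.
by apply: (mulgI (V h)); rewrite -V_morph mulKVg mulg1.
Qed.

(** Precomposition with [V] is needed because [sd_map] applies the scalar before moving the
    indices. *)
Let char h g := KUnit (c_neq0 h (V g)).

Let char_morph h : {morph char h : a b / (a * b)%g}.
Proof. by move=> a b; apply: val_inj; rewrite /= V_morph cMr. Qed.

Let char_hom h : dual_group k G := mk_hom (char_morph h).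

Let char_hom_morph : {morph char_hom : g h / (g * h)%g}.
Proof.
move=> g h; apply/homP => a; rewrite hom_mulE !mk_homE.
by apply: val_inj; rewrite /= cMl.
Qed.

Lemma hopf_aut_group_elt :
  exists s : sdprod_group k G, forall h, sd_lfun s (group_elt k h) = f (group_elt k h).
Proof.
exists (SDProd (gaut_of V_inj V_morph) (mk_hom char_hom_morph)) => h.
apply: (@gaut_coordP _ _ (gaut_of V_inj V_morph)) => a y.
rewrite sd_lfun_coordE /sd_coef /= !mk_homE /= !gaut_ofE -/(x h) xE group_eltE.
rewrite (inj_eq V_inj); have [->|_] := eqVneq y h; first by rewrite mulr1 mul1r.
by rewrite mulr0 mul0r.
Qed.

End GroupLikeImages.

(** * Surjectivity and the isomorphism *)

Lemma sd_lfun_surj (k : fieldType) (G : finGroupType) (f : 'End(drinfeld k G)) :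
  'Z([set: G])%g = 1%g -> is_hopf_aut f -> exists s, sd_lfun s = f.
Proof.
move=> hZ fH; have [s sE] := hopf_aut_group_elt fH hZ; exists s.
have gH := is_hopf_autM (sd_lfun_hopf s^-1%g) fH.
have g1 h : (sd_lfun s^-1%g \o f)%VF (group_elt k h) = group_elt k h.
  by rewrite comp_lfunE -sE -comp_lfunE -sd_lfunM mulVg sd_lfun1 id_lfunE.
have := hopf_aut_fixing_group gH g1 hZ.
move/(congr1 (fun g => sd_lfun s \o g)%VF).
by rewrite comp_lfun1r comp_lfunA -sd_lfunM mulgV sd_lfun1 comp_lfun1l.
Qed.

Theorem corollary5p9 (k : closedFieldType) (hk : [pchar k] =i pred0)
    (G : finGroupType) (hZ : 'Z([set: G])%g = 1%g) :
  exists F : {multiplicative sdprod_group k G -> hopf_aut k G},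
    [/\ bijective F,
        forall (v : gaut G) (g h : G),
          F (SDProd v 1%g) (dbase (g, h)) = dbase (v g, v h)
      & forall (r : ghom G (dual_group k G)) (g h : G),
          F (SDProd 1%g r) (dbase (g, h))
            = kunit_val (r h g) *: dbase (g, h)].
Proof.
exists (@sd_hopf k G : {multiplicative _ -> _}); split=> [|v g h|r g h].
(* A choice of preimages is a right inverse; injectivity makes it two-sided. *)
- have [f' f'K] := choice (fun f : hopf_aut k G => sd_lfun_surj hZ (hopf_autP f)).
  exists f' => [s|f]; last by apply: val_inj; exact: f'K.
  by apply: sd_lfun_inj; exact: f'K.
- by rewrite [LHS]sd_lfun_dbase /sd_coef /= !ghom_oneE scale1r.
- by rewrite [LHS]sd_lfun_dbase /= !gaut1E.
Qed.
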